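(* Let $m,n\ge 1$ be integers, let $A(m,n)$ be the aisle graph with reward function $r$ and unit edge costs, and let $B\ge 0$ be a budget. There is an algorithm that solves the full-row constant-cost orienteering problem COP-FR on $(A(m,n),r,B)$ optimally, i.e. that outputs a full-row closed walk starting and ending at $v_{1,0}$ of cost at most $B$ whose collected reward is maximum among all such full-row closed walks, and it runs in time $\mathcal{O}(m\cdot\max\{n,m\})$.
   Context: The aisle graph $A(m,n)=(V,E)$ has vertex set $V=\{v_{i,j}: 1\le i\le m,\ 0\le j\le n+1\}$ (rows $i$, columns $j$). Its edges are: the horizontal edges $\{v_{i,j},v_{i,j+1}\}$ for $1\le i\le m$, $0\le j\le n$; and the vertical edges $\{v_{i,0},v_{i+1,0}\}$ and $\{v_{i,n+1},v_{i+1,n+1}\}$ for $1\le i\le m-1$. Thus a robot can change row only in column $0$ or column $n+1$. Every edge has cost $1$. A reward function $r:V\to\mathbb{R}_{\ge 0}$ is given with $r(v_{i,0})=r(v_{i,n+1})=0$ for all $i$. The cost of a walk is its number of edge traversals (counted with multiplicity); the reward collected by a walk is the sum of $r(v)$ over the distinct vertices $v$ it visits (each vertex's reward is collected at most once). The constant-cost orienteering problem (COP) asks for a closed walk starting and ending at $v_{1,0}$ of cost at most $B$ with maximum collected reward. A closed walk is full-row if it never reverses direction at a vertex $v_{i,j}$ with $1\le j\le n$, i.e. whenever it enters a row at one end it traverses that entire row to the other end (the robot can neither turn around nor reverse inside a row). COP-FR is COP restricted to full-row closed walks. Running time is measured with unit-cost arithmetic and comparison operations on rewards. *)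

(* Defs.v *)
From HB Require Import structures.
From mathcomp Require Import all_boot all_order all_algebra.
From mathcomp Require Import reals.

Set Implicit Arguments.
Unset Strict Implicit.
Unset Printing Implicit Defensive.

Import Order.TTheory GRing.Theory Num.Theory.
Local Open Scope ring_scope.

(* Rows are numbered from 0: the pair (i, j) is the vertex v_{i+1,j}. *)
Definition vertex (m n : nat) : Type := ('I_m * 'I_n.+2)%type.

Section AisleGraph.
Variables m n : nat.
Implicit Types (v x y z : vertex m n) (w : seq (vertex m n)).

Definition vrow v : nat := v.1.
Definition vcol v : nat := v.2.

Definition interior v : bool := (0 < vcol v < n.+1)%N.

Definition consecutive (a b : nat) : bool := (b == a.+1) || (a == b.+1).

Definition adj : rel (vertex m n) := fun x y =>
  ((vrow x == vrow y) && consecutive (vcol x) (vcol y))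
  || [&& (vcol x == 0%N) || (vcol x == n.+1), vcol x == vcol y &
         consecutive (vrow x) (vrow y)].

(* A walk is the sequence of the vertices it goes through, in order and with
   repetitions; the one-vertex sequence is the closed walk of cost 0. *)
Definition closed_walk w : bool :=
  if w is x :: p then
    [&& vrow x == 0%N, vcol x == 0%N, path adj x p & last x p == x]
  else false.

Definition cost w : nat := (size w).-1.

Definition full_row w : Prop :=
  forall x y z, infix [:: x; y; z] w -> interior y -> x <> z.

Variable R : realType.

(* The sum is over the finite type of vertices, so that a vertex visited
   several times is counted once. *)
Definition reward (r : vertex m n -> R) w : R := \sum_(v | v \in w) r v.

Definition COP_FR_feasible (B : R) w : Prop :=
  [/\ closed_walk w, full_row w & (cost w)%:R <= B].

Definition COP_FR_optimal (r : vertex m n -> R) (B : R) w : Prop :=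
  COP_FR_feasible B w /\
  forall w', COP_FR_feasible B w' -> reward r w' <= reward r w.

End AisleGraph.

(* Model of computation: a unit-cost random access machine in structured form.
   The memory consists of arrays of natural numbers and arrays of real numbers,
   both named by natural numbers and of unbounded length; a scalar variable is
   a cell of an array. Naturals have +, truncated - and comparison; reals have
   the field operations and comparison. A real can influence a natural, an
   address or the control flow only through comparisons (no floor). Literals
   are natural numbers, so a program is a finite object independent of the
   instance. *)
Inductive iexp : Type :=
  | ILit of nat
  | IGet of nat & iexp
  | IAdd of iexp & iexp
  | ISub of iexp & iexp.

Inductive rexp : Type :=
  | RLit of nat
  | RGet of nat & iexp
  | RAdd of rexp & rexp
  | RSub of rexp & rexp
  | RMul of rexp & rexp
  | RDiv of rexp & rexp.

Inductive bexp : Type :=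
  | BILe of iexp & iexp
  | BRLe of rexp & rexp
  | BNot of bexp
  | BAnd of bexp & bexp.

(* ISet a e e' is the assignment a[e] := e' in the array a of naturals, and
   RSet is the same for arrays of reals. *)
Inductive cmd : Type :=
  | Skip
  | ISet of nat & iexp & iexp
  | RSet of nat & iexp & rexp
  | Seq of cmd & cmd
  | If of bexp & cmd & cmd
  | While of bexp & cmd.

Section Semantics.
Variable R : realType.

Record state : Type := State {
  imem : nat -> nat -> nat;
  rmem : nat -> nat -> R }.
Implicit Type s : state.

Definition update (T : Type) (f : nat -> nat -> T) (a k : nat) (x : T) :
    nat -> nat -> T :=
  fun a' k' => if (a' == a) && (k' == k) then x else f a' k'.

Fixpoint ieval s (e : iexp) : nat :=
  match e with
  | ILit c => c
  | IGet a e1 => imem s a (ieval s e1)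
  | IAdd e1 e2 => (ieval s e1 + ieval s e2)%N
  | ISub e1 e2 => (ieval s e1 - ieval s e2)%N
  end.

Fixpoint reval s (e : rexp) : R :=
  match e with
  | RLit c => c%:R
  | RGet a e1 => rmem s a (ieval s e1)
  | RAdd e1 e2 => reval s e1 + reval s e2
  | RSub e1 e2 => reval s e1 - reval s e2
  | RMul e1 e2 => reval s e1 * reval s e2
  | RDiv e1 e2 => reval s e1 / reval s e2
  end.

Fixpoint beval s (b : bexp) : bool :=
  match b with
  | BILe e1 e2 => (ieval s e1 <= ieval s e2)%N
  | BRLe e1 e2 => reval s e1 <= reval s e2
  | BNot b1 => ~~ beval s b1
  | BAnd b1 b2 => beval s b1 && beval s b2
  end.

(* Time to evaluate an expression: one unit for each of its nodes. *)
Fixpoint itime (e : iexp) : nat :=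
  match e with
  | ILit _ => 1
  | IGet _ e1 => (itime e1).+1
  | IAdd e1 e2 | ISub e1 e2 => (itime e1 + itime e2).+1
  end.

Fixpoint rtime (e : rexp) : nat :=
  match e with
  | RLit _ => 1
  | RGet _ e1 => (itime e1).+1
  | RAdd e1 e2 | RSub e1 e2 | RMul e1 e2 | RDiv e1 e2 =>
      (rtime e1 + rtime e2).+1
  end.

Fixpoint btime (b : bexp) : nat :=
  match b with
  | BILe e1 e2 => (itime e1 + itime e2).+1
  | BRLe e1 e2 => (rtime e1 + rtime e2).+1
  | BNot b1 => (btime b1).+1
  | BAnd b1 b2 => (btime b1 + btime b2).+1
  end.

(* exec c s t s': started in s, the command c terminates in s' after time t. *)
Inductive exec : cmd -> state -> nat -> state -> Prop :=
  | exec_skip s : exec Skip s 1 s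
  | exec_iset s a e e' :
      exec (ISet a e e') s (itime e + itime e').+1
        (State (update (imem s) a (ieval s e) (ieval s e')) (rmem s))
  | exec_rset s a e e' :
      exec (RSet a e e') s (itime e + rtime e').+1
        (State (imem s) (update (rmem s) a (ieval s e) (reval s e')))
  | exec_seq s1 s2 s3 c1 c2 t1 t2 :
      exec c1 s1 t1 s2 -> exec c2 s2 t2 s3 ->
      exec (Seq c1 c2) s1 (t1 + t2) s3
  | exec_if s s' b c1 c2 t :
      exec (if beval s b then c1 else c2) s t s' ->
      exec (If b c1 c2) s (btime b + t).+1 s'
  | exec_while_false s b c :
      ~~ beval s b -> exec (While b c) s (btime b).+1 s
  | exec_while_true s1 s2 s3 b c t1 t2 :
      beval s1 b -> exec c s1 t1 s2 -> exec (While b c) s2 t2 s3 ->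
      exec (While b c) s1 (btime b + t1 + t2).+1 s3.

Lemma exec_det c s t1 s1 t2 s2 :
  exec c s t1 s1 -> exec c s t2 s2 -> t1 = t2 /\ s1 = s2.
Proof.
move=> E1; elim: E1 t2 s2 => {c s t1 s1}.
- by move=> s t2 s2 E; inversion E.
- by move=> s a e e' t2 s2 E; inversion E.
- by move=> s a e e' t2 s2 E; inversion E.
- move=> s1 s2 s3 c1 c2 t1 t2 _ IH1 _ IH2 t s E.
  inversion E as [| | |? s2' ? ? ? ? ? F1 F2| | |]; subst.
  have [-> es] := IH1 _ _ F1; rewrite -es in F2.
  by have [-> ->] := IH2 _ _ F2.
- move=> s s' b c1 c2 t _ IH t2 s2 E.
  inversion E as [| | | |? ? ? ? ? ? F| |]; subst.
  by have [-> ->] := IH _ _ F.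
- move=> s b c nb t2 s2 E.
  inversion E as [| | | | | |? ? ? ? ? ? ? hb]; subst => //.
  by rewrite hb in nb.
- move=> s1 s2 s3 b c t1 t2 hb _ IH1 _ IH2 t s E.
  inversion E as [| | | | |? ? ? nb|? s2' ? ? ? ? ? _ F1 F2]; subst.
    by rewrite hb in nb.
  have [-> es] := IH1 _ _ F1; rewrite -es in F2.
  by have [-> ->] := IH2 _ _ F2.
Qed.

(* Input: the array 0 of naturals holds m and n, the cell 0 of the array 0 of
   reals holds B, and the array 1 of reals holds the rewards in row-major
   order; all other cells are 0. *)
Definition input (m n : nat) (r : vertex m n -> R) (B : R) : state :=
  State
    (fun a k =>
       match a, k with
       | 0%N, 0%N => m
       | 0%N, 1%N => n
       | _, _ => 0%N
       end)
    (fun a k =>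
       match a, k with
       | 0%N, 0%N => B
       | 1%N, _ =>
           if [pick v : vertex m n | (vrow v * n.+2 + vcol v)%N == k] is Some v
           then r v else 0
       | _, _ => 0
       end).

(* Output: the cell 0 of the array 1 of naturals holds the number of vertices
   of the walk, whose rows and columns are listed in the arrays 2 and 3. *)
Definition output s : seq (nat * nat) :=
  [seq (imem s 2 k, imem s 3 k) | k <- iota 0 (imem s 1 0)].

End Semantics.

(* Main.v *)
(** Let a full-row closed walk reach row [h] and cross the rows of a set [S].
    Every entered row is crossed entirely and the total number of crossings is
    even, so the walk costs at least [2 h + 2 q (n + 1)] for some [q] with
    [#|S| <= 2 q]. Conversely, for every [S] contained in the rows up to [h] with
    [#|S| <= 2 q] this cost suffices: go down the left side to row [h], cross the
    rows of [S] on the way up, and cross row [0] back if this ends on the right.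
    Hence the optimum is the maximum, over the affordable pairs [(h, q)], of the
    best total reward of at most [2 q] of the rows up to [h]. A knapsack-like
    dynamic program over (rows, number of rows chosen) computes all these values
    in time [O(m^2)] after the row sums have been computed in time [O(m n)], and
    backtracking in its table produces [S] in the order in which the way up
    needs it.

    Natural arrays: 4 holds the loop counters, 5 and 6 the multiples of [n + 2]
    and [2 m + 1] used as row offsets, 7 the chosen [h] and the number of
    crossings left, 8 the current column. Real arrays: 3 holds the casts of the
    naturals, 4 the row sums, 5 the dynamic programming table, 6 the best value
    found. *)
Require Import Defs.
From HB Require Import structures.
From mathcomp Require Import all_boot all_order all_algebra.
From mathcomp Require Import reals.
From mathcomp Require Import zify.

Set Implicit Arguments.
Unset Strict Implicit.
Unset Printing Implicit Defensive.

Import Order.TTheory GRing.Theory Num.Theory.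
Local Open Scope ring_scope.

(** * Timed execution of structured programs *)

Section Logic.
Variable R : realType.
Implicit Types (s : state R) (Q : state R -> Prop).

Definition runs c s T Q :=
  exists t s', [/\ exec c s t s', (t <= T)%N & Q s'].

Lemma runs_mono c s (T1 T2 : nat) Q1 Q2 :
  runs c s T1 Q1 -> (T1 <= T2)%N -> (forall s', Q1 s' -> Q2 s') ->
  runs c s T2 Q2.
Proof.
move=> [t [s' [E tT q]]] le_T sub; exists t, s'.
by split=> //; [exact: leq_trans le_T | exact: sub].
Qed.

Lemma runs_le c s (T1 T2 : nat) Q :
  runs c s T1 Q -> (T1 <= T2)%N -> runs c s T2 Q.
Proof. by move=> H le_T; exact: runs_mono H le_T _. Qed.

Lemma runs_seq c1 c2 s T1 T2 P Q :
  runs c1 s T1 P -> (forall s', P s' -> runs c2 s' T2 Q) ->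
  runs (Seq c1 c2) s (T1 + T2) Q.
Proof.
move=> [t1 [s1 [E1 le1 p]]] /(_ _ p) [t2 [s2 [E2 le2 q]]].
by exists (t1 + t2)%N, s2; split=> //; [exact: exec_seq E1 E2 | exact: leq_add].
Qed.

Lemma runs_if b c1 c2 s T Q :
  (beval s b -> runs c1 s T Q) -> (~~ beval s b -> runs c2 s T Q) ->
  runs (If b c1 c2) s (btime b + T).+1 Q.
Proof.
move=> H1 H2.
have [t [s' [E le q]]] : runs (if beval s b then c1 else c2) s T Q.
  by case: (boolP (beval s b)).
exists (btime b + t).+1, s'; split=> //; first exact: exec_if.
by rewrite ltnS leq_add2l.
Qed.

(** Weakest precondition for loop-free code. A loop gets [False], so [runs_wp] never applies to one
    and the value of [ctime] at [While] is harmless; loops go through [runs_for]. *)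
Fixpoint wp c Q s : Prop :=
  match c with
  | Skip => Q s
  | ISet a e e' =>
      Q (State (update (imem s) a (ieval s e) (ieval s e')) (rmem s))
  | RSet a e e' =>
      Q (State (imem s) (update (rmem s) a (ieval s e) (reval s e')))
  | Seq c1 c2 => wp c1 (wp c2 Q) s
  | If b c1 c2 => if beval s b then wp c1 Q s else wp c2 Q s
  | While _ _ => False
  end.

Fixpoint ctime c : nat :=
  match c with
  | Skip => 1
  | ISet _ e e' => (itime e + itime e').+1
  | RSet _ e e' => (itime e + rtime e').+1
  | Seq c1 c2 => (ctime c1 + ctime c2)%N
  | If b c1 c2 => (btime b + maxn (ctime c1) (ctime c2)).+1
  | While _ _ => 0
  end.

Lemma runs_wp c s T Q : wp c Q s -> (ctime c <= T)%N -> runs c s T Q.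
Proof.
move=> H le_T; suff /runs_mono : runs c s (ctime c) Q by apply.
move: H => {le_T}.
elim: c s Q => [|a e e'|a e e'|c1 IH1 c2 IH2|b c1 IH1 c2 IH2|//] s Q /= H.
- by exists 1%N, s; split=> //; constructor.
- by eexists _, _; split; [constructor| |exact: H].
- by eexists _, _; split; [constructor| |exact: H].
- by apply: runs_seq (IH1 _ _ H) _ => s' /IH2.
- apply: runs_if => Hb; rewrite ?Hb ?(negbTE Hb) in H.
    by apply: runs_mono (IH1 _ _ H) _ _; rewrite ?leq_maxl.
  by apply: runs_mono (IH2 _ _ H) _ _; rewrite ?leq_maxr.
Qed.

Definition iset s a k x : state R := State (update (imem s) a k x) (rmem s).

End Logic.

Definition counter x := IGet 4 (ILit x).

Definition For x e body :=
  Seq (ISet 4 (ILit x) (ILit 0))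
    (While (BNot (BILe e (counter x)))
       (Seq body (ISet 4 (ILit x) (IAdd (counter x) (ILit 1))))).

(** Induction on the number of iterations left. The invariant has to ignore the loop's own counter
    cell, which the increment rewrites. The 20 covers test and increment, and the extra round in
    [N.+1] pays for the initialisation and the last test. *)
Lemma runs_for (R : realType) (Inv : nat -> state R -> Prop) N T x e body s :
  (forall k s, Inv k s -> forall v, Inv k (iset s 4 x v)) ->
  (forall k s, Inv k s -> ieval s e = N) ->
  (forall k s, (k < N)%N -> Inv k s -> imem s 4 x = k ->
     runs body s T (fun s' => Inv k.+1 s' /\ imem s' 4 x = k)) ->
  Inv 0%N s ->
  runs (For x e body) s (N.+1 * (T + itime e + 20)) (Inv N).
Proof.
move=> Hx He Hb H0.
rewrite /For; set w := While _ _.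
suff W k d s1 : (d + k = N)%N -> Inv k s1 -> imem s1 4 x = k ->
    runs w s1 (d * (T + itime e + 20) + itime e + 10) (Inv N).
  have [t [s' [E le q]]] : runs w (iset s 4 x 0) (N * (T + itime e + 20) +
      itime e + 10) (Inv N).
    apply: (W 0%N); rewrite ?addn0 //; first exact: Hx.
    by rewrite /= /update !eqxx.
  exists (3 + t)%N, s'; split=> //; last by lia.
  apply: exec_seq E; exact: exec_iset.
elim: d k s1 => [|d IH] k s1 dk H1 ek.
  exists (itime e + 5)%N, s1; split=> //; last 2 first.
  - lia.
  - by move: H1; rewrite -dk.
  - have -> : (itime e + 5)%N = (btime (BNot (BILe e (counter x)))).+1.
      by rewrite /=; lia.
    by apply: exec_while_false; rewrite /= (He _ _ H1) ek -dk leqnn.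
have [t [s2 [E2 le2 [H2 ek2]]]] := Hb k s1 ltac:(lia) H1 ek.
have [] := IH k.+1 (iset s2 4 x k.+1).
- lia.
- exact: Hx.
- by rewrite /= /update !eqxx.
move=> t3 [s3 [E3 le3 H3]]; exists
  ((btime (BNot (BILe e (counter x)))) + (t + 6) + t3).+1, s3; split=> //.
- apply: exec_while_true E3.
    by rewrite /= (He _ _ H1) ek -ltnNge; lia.
  apply: exec_seq E2 _.
  have -> : iset s2 4 x k.+1 = State (update (imem s2) 4 (ieval s2 (ILit x))
     (ieval s2 (IAdd (counter x) (ILit 1)))) (rmem s2).
    by rewrite /= ek2 addn1.
  exact: exec_iset.
- by rewrite /=; lia.
Qed.

(** * Lower bound on the cost of full-row walks *)

Section LowerBound.
Variables m n : nat.
Hypothesis n_gt0 : (0 < n)%N.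
Implicit Types (v x y z : vertex m n) (S : {set 'I_m}).
Local Open Scope nat_scope.

(* [c] counts the completed crossings, so its parity tells the side of the
   graph on which the walk is, or from which it entered the current row. *)
Definition position_bound x y (k c h a : nat) : Prop :=
  if vcol y == 0 then [/\ ~~ odd c, a <= c & c * n.+1 + 2 * h <= k + vrow y]
  else if vcol y == n.+1 then
    [/\ odd c, a <= c & c * n.+1 + 2 * h <= k + vrow y]
  else [/\ vrow x = vrow y, a <= c.+1 &
    if odd c then vcol x = (vcol y).+1 /\
      c * n.+1 + 2 * h + (n.+1 - vcol y) <= k + vrow y
    else vcol y = (vcol x).+1 /\
      c * n.+1 + 2 * h + vcol y <= k + vrow y].

(** The walk has made [k] steps, the last one from [x] to [y]; [S] collects the entered rows. Going
    to row [h] and back to the row of [y] takes [2 * h - vrow y] vertical steps, hence the potential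
    [k + vrow y] in [position_bound]. *)
Definition walk_bound (l : seq (vertex m n)) x y k c h S : Prop :=
  [/\ h < m, forall v, v \in l -> vrow v <= h,
      forall v, v \in l -> interior v -> v.1 \in S,
      forall i, i \in S -> i <= h & y \in l] /\
  position_bound x y k c h #|S|.

Lemma walk_bound_step l x y z k c h S :
  walk_bound l x y k c h S -> adj y z -> (interior y -> x <> z) ->
  exists c' h' S', walk_bound (z :: l) y z k.+1 c' h' S'.
Proof.
move=> [[hm lh lS Sh yl] pb] ayz ny.
have yh := lh _ yl.
have colz : vcol z <= n.+1 by rewrite /vcol -ltnS ltn_ord.
have coly : vcol y <= n.+1 by rewrite /vcol -ltnS ltn_ord.
have rowz : vrow z < m by exact: ltn_ord.
have xzE : vrow x = vrow z -> vcol x = vcol z -> x = z.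
  case: x z {ny pb ayz colz rowz} => [x1 x2] [z1 z2] e1 e2.
  by congr (_, _); apply: val_inj.
case/orP: ayz => [/andP [/eqP erow ccol]|/and3P[ybd /eqP ecol crow]].
- case: (boolP (interior y)) => iy.
    (* Inside a row, [x <> z] leaves only the direction of entry: the crossing advances, and [c]
       grows exactly when [z] is in a boundary column. *)
    have Hpb : exists c', position_bound y z k.+1 c' h #|S|.
      have {}ny := ny iy.
      move: pb iy ccol; rewrite /position_bound /interior /consecutive.
      case: eqP => [->//|y0]; case: eqP => [->|yn]; first by rewrite ltnn andbF.
      move=> [exy aS]; case: (boolP (odd c)) => oc [ec le] _ /orP[] /eqP ecz.
      + by case: ny; apply: xzE; lia.
      + case: eqP => z0; last case: eqP => zn.
        * by exists c.+1; rewrite /= oc; split=> //; rewrite mulSn; lia.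
        * lia.
        * by exists c; rewrite oc; split=> //; split=> //; lia.
      + case: eqP => z0; last case: eqP => zn.
        * lia.
        * by exists c.+1; rewrite /= oc; split=> //; rewrite mulSn; lia.
        * by exists c; rewrite (negbTE oc); split=> //; split=> //; lia.
      + by case: ny; apply: xzE; lia.
    have yS := lS _ yl iy; have [c' {}pb] := Hpb.
    have ez : z.1 = y.1 by apply: val_inj; exact: esym.
    exists c', h, S; split=> //; split=> //.
    + by move=> v; rewrite inE => /orP[/eqP ->|/lh//]; rewrite -erow.
    + by move=> v; rewrite inE => /orP[/eqP -> _|/lS//]; rewrite ez.
    + by rewrite inE eqxx.
  (* Entering a row opens a crossing not yet counted in [c]; the slack [a <= c.+1] pays for the
     possibly new row, and [0 < n] makes [z] interior. *)
  exists c, h, (z.1 |: S); split; last first.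
    have cS : #|z.1 |: S| <= #|S|.+1 by rewrite cardsU1; case: (z.1 \notin S); rewrite ?add1n ?add0n.
    move: #|_| #|S| cS pb iy ccol => a' a cS.
    rewrite /position_bound /interior /consecutive.
    case: eqP => [y0|y0].
      move=> [oc aS le] _ cz.
      have -> : vcol z = 1 by lia.
      rewrite /=; case: eqP => [|_]; first by lia.
      by rewrite (negbTE oc); split; [|lia|lia].
    case: eqP => [yn|]; last by lia.
    move=> [oc aS le] _ cz.
    have -> : vcol z = n by lia.
    case: eqP => [|_]; first by lia.
    case: eqP => [|_]; first by lia.
    by rewrite oc; split; [|lia|lia].
  split=> //.
  - by move=> v; rewrite inE => /orP[/eqP ->|/lh//]; rewrite -erow.
  - move=> v; rewrite inE => /orP[/eqP -> _|/lS Sv /Sv]; rewrite !inE ?eqxx //.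
    by move=> ->; rewrite orbT.
  - by move=> i; rewrite !inE => /orP[/eqP ->|/Sh//]; rewrite -/(vrow z) -erow.
  - by rewrite inE eqxx.
(* A vertical step away from row 0 adds 2 to the potential, which pays for [h] growing by at most 1;
   a step towards row 0 changes neither side. *)
- exists c, (maxn h (vrow z)), S; split; last first.
    move: pb; rewrite /position_bound -ecol.
    case/orP: ybd => ->; last case: ifP => _; move: crow;
      by rewrite /consecutive => ? [oc aS le]; split=> //; lia.
  split=> //; rewrite ?gtn_max ?hm //.
  - by move=> v; rewrite inE => /orP[/eqP ->|/lh ?]; lia.
  - move=> v; rewrite inE => /orP[/eqP ->|/lS//].
    by rewrite /interior -ecol; lia.
  - by move=> i /Sh ?; lia.
  - by rewrite inE eqxx.
Qed.

Lemma walk_bound_path p l x y k c h S :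
  walk_bound l x y k c h S -> path (@adj m n) y p ->
  full_row (x :: y :: p) ->
  exists l' x' c' h' S',
    walk_bound l' x' (last y p) (k + size p) c' h' S' /\
    (forall v, (v \in l') = (v \in l) || (v \in p)).
Proof.
elim: p l x y k c h S => [|z p IH] l x y k c h S wb.
  move=> _ _; exists l, x, c, h, S; rewrite addn0; split=> // v.
  by rewrite in_nil orbF.
move=> /= /andP[ayz pz] fr.
have [|c' [h' [S' wb']]] := walk_bound_step wb ayz.
  by apply: fr; rewrite prefixW // /prefix /= !eqxx; case: (p).
have fr' : full_row (y :: z :: p).
  by move=> a b d ab; apply: fr; exact: infix_trans (infix_cons _ _).
have [l' [x' [c2 [h2 [S2 [wb2 e]]]]]] := IH _ _ _ _ _ _ _ wb' pz fr'.
exists l', x', c2, h2, S2; rewrite addnS -addSn; split=> // v.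
by rewrite e !inE; case: (v == z); rewrite ?orbT.
Qed.

(** Back in column 0 the number of crossings is even, and half of it serves as [q]. *)
Lemma full_row_cost w : 0 < m -> closed_walk w -> full_row w ->
  exists q h (S : {set 'I_m}),
    [/\ h < m, forall i, i \in S -> i <= h,
        forall v, v \in w -> interior v -> v.1 \in S,
        #|S| <= q + q & 2 * h + 2 * (q * n.+1) <= cost w].
Proof.
move=> m_gt0; case: w => //= x p /and4P[/eqP x0 /eqP y0 px /eqP lx] fr.
(* The depot stands in for its own missing predecessor; it is not interior, so the prepended copy
   creates no forbidden reversal. *)
have [||l [x' [c [h [S [[[hm lh lS Sh _] pb] e]]]]]] :=
  @walk_bound_path p [:: x] x x 0 0 0 set0 _ px.
- split; last by rewrite /position_bound y0 /= cards0.
  split=> //.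
  + by move=> v; rewrite inE => /eqP ->; rewrite x0.
  + by move=> v; rewrite inE => /eqP ->; rewrite /interior y0.
  + by move=> i; rewrite inE.
  + by rewrite inE.
- move=> a b d; rewrite infix_consl => /orP[|/fr//].
  rewrite /prefix /= => /andP[/eqP _ /andP[/eqP -> _]].
  by rewrite /interior y0.
move: pb; rewrite lx /position_bound y0 eqxx => -[oc aS le].
exists c./2, h, S; split=> //.
- by move=> v vp; apply: lS; rewrite e -cat1s -mem_cat in vp *.
- by rewrite addnn even_halfK.
- move: le; rewrite x0 !addn0 add0n -{1}(even_halfK oc) /cost /= -muln2.
  by move: (c./2) (size p) => q k; nia.
Qed.
End LowerBound.

(** * Row rewards and the knapsack recurrence *)

Section Reward.
Variables (R : realType) (m n : nat) (r : vertex m n -> R).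
Hypothesis r_ge0 : forall v, 0 <= r v.
Hypothesis r_bd : forall v, vcol v = 0%N \/ vcol v = n.+1 -> r v = 0.

Definition row_reward (i : nat) : R := \sum_(v : vertex m n | vrow v == i) r v.

(** Boundary columns carry no reward, and by nonnegativity counting the rows of [S] in full can only
    increase the sum. *)
Lemma reward_le_rows (w : seq (vertex m n)) (S : {set 'I_m}) :
  (forall v, v \in w -> interior v -> v.1 \in S) ->
  reward r w <= \sum_(i in S) row_reward i.
Proof.
move=> wS.
apply: (@le_trans _ _ (\sum_(v : vertex m n | v.1 \in S) r v)).
  rewrite /reward big_mkcond [leRHS]big_mkcond; apply: ler_sum => v _.
  case: ifP => vw; last by case: ifP.
  case: (boolP (interior v)) => [/(wS _ vw) ->//|iv].
  rewrite r_bd; first by case: ifP.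
  by move: iv; rewrite /interior /vcol; move: (nat_of_ord v.2) (ltn_ord v.2) => j; lia.
rewrite (partition_big (fun v : vertex m n => v.1) (mem S)) //=.
apply: ler_sum => i iS; rewrite /row_reward le_eqVlt; apply/orP; left; apply/eqP.
apply: eq_bigl => v; rewrite /vrow -[RHS]/(v.1 == i).
by case: eqP => [->|]; rewrite ?iS ?andbF.
Qed.

(** The knapsack value: the largest total weight of at most [j] rows below [h]. [best_ub] proves the
    upper bound; that the value is attained follows later from the emitted walk. *)
Fixpoint best (w : nat -> R) (h j : nat) : R :=
  match h, j with
  | h'.+1, j'.+1 => Num.max (best w h' j) (best w h' j' + w h')
  | _, _ => 0
  end.

Lemma best_col0 w h : best w h 0 = 0. Proof. by case: h. Qed.

Lemma best_ub (w : nat -> R) h j (S : {set 'I_m}) :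
  (forall i, i \in S -> (i < h)%N) -> (#|S| <= j)%N ->
  \sum_(i in S) w i <= best w h j.
Proof.
elim: h j S => [|h IH] j S Sh cS.
  rewrite big1 // => i /Sh; by rewrite ltn0.
case: j cS => [|j] cS.
  by move: cS; rewrite leqn0 cards_eq0 => /eqP ->; rewrite big_set0.
rewrite /= le_max.
case: (boolP [exists i in S, i == h :> nat]) => [/exists_inP[i iS /eqP ei]|nS].
  apply/orP; right; rewrite (big_setD1 i) //= ei addrC lerD2r; apply: IH.
    move=> i'; rewrite !inE => /andP[ne /Sh]; rewrite ltnS leq_eqVlt.
    by case/orP=> // /eqP e; case/eqP: ne; apply: val_inj; rewrite /= e.
  by move: cS; rewrite (cardsD1 i) iS.
apply/orP; left; apply: IH => // i iS.
have := Sh _ iS; rewrite ltnS leq_eqVlt => /orP[e|//].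
by case/exists_inP: nS; exists i.
Qed.

(** The backtracking test: a strict increase can only come from taking row [h], which uses up one of
    the [j] choices. *)
Lemma best_take w h j : ~~ (best w h.+1 j <= best w h j) ->
  (0 < j)%N /\ best w h.+1 j = best w h j.-1 + w h.
Proof.
case: j => [|j] /=; first by rewrite best_col0 lexx.
by rewrite ge_max lexx /= -ltNge => /ltW/max_idPr ->.
Qed.

Lemma best_skip w h j : best w h.+1 j <= best w h j ->
  best w h.+1 j = best w h j.
Proof.
case: j => [|j] /=; first by rewrite best_col0.
by rewrite ge_max lexx /= => /max_idPl ->.
Qed.

End Reward.

(** * Full-row walks in integer coordinates *)

Section GoodWalk.
Variables m n : nat.

Definition coords (v : vertex m n) : nat * nat := (vrow v, vcol v).

Lemma coords_inj : injective coords.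
Proof. by move=> [a b] [c d] [e f]; congr (_, _); exact: val_inj. Qed.

Definition nadj (x y : nat * nat) : bool :=
  ((x.1 == y.1) && consecutive x.2 y.2)
  || [&& (x.2 == 0%N) || (x.2 == n.+1), x.2 == y.2 & consecutive x.1 y.1].

(* A full-row walk from the depot in coordinates, with its last two vertices. *)
Inductive good_walk : seq (nat * nat) -> nat * nat -> nat * nat -> Prop :=
  | good_start : good_walk [:: (0, 0)%N] (0, 0)%N (0, 0)%N
  | good_step l x y z : good_walk l x y -> nadj y z ->
      ((0 < y.2 < n.+1)%N -> x <> z) -> (z.1 < m)%N -> (z.2 <= n.+1)%N ->
      good_walk (rcons l z) y z.

(** Transfers an emitted list of pairs back to the graph. The clause on suffixes identifies the
    predecessor of the last vertex, which the no-reversal condition of the next step refers to. *)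
Lemma good_walkP l x y : (0 < m)%N -> good_walk l x y ->
  exists v p, [/\ coords v = (0, 0)%N, l = map coords (v :: p),
    path (@adj m n) v p, coords (last v p) = y & full_row (v :: p)] /\
    (forall a b, suffix [:: a; b] (v :: p) -> coords a = x).
Proof.
move=> m_gt0; elim=> {l x y} [|l x y z _ [v [p [[v0 -> pp lp fr] sx]]] ayz nyz z1 z2].
  exists (Ordinal m_gt0, ord0), [::]; split.
    split=> // a b c; by move/size_infix.
  by move=> a b /size_suffix.
pose u : vertex m n := (Ordinal z1, Ordinal (z2 : (z.2 < n.+2)%N)).
have cu : coords u = z by rewrite /coords /vrow /vcol -surjective_pairing.
have eu : (v :: p) = rcons (belast v p) (last v p) by rewrite lastI.
exists v, (rcons p u); split; last first.
  move=> a b; rewrite -rcons_cons eu.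
  have -> : [:: a; b] = rcons [:: a] b by [].
  rewrite suffix_rcons => /andP[_].
  have -> : [:: a] = rcons [::] a by [].
  by rewrite suffix_rcons => /andP[/eqP -> _].
split=> //.
- by rewrite -rcons_cons map_rcons cu.
- rewrite rcons_path pp /=; move: ayz; rewrite -lp -cu; exact.
- by rewrite last_rcons.
(* Three consecutive vertices either lie in the old walk or consist of its last two vertices and the
   new one. *)
- move=> a b c; rewrite -rcons_cons infix_rconsl => /orP[|]; last exact: fr.
  have -> : [:: a; b; c] = rcons [:: a; b] c by [].
  rewrite suffix_rcons => /andP[/eqP ec sab].
  have ea := sx _ _ sab.
  have eb : coords b = y.
    move: sab; rewrite eu (_ : [:: a; b] = rcons [:: a] b) // suffix_rcons.
    by case/andP=> /eqP -> _.
  move=> ib eac; apply: nyz; first by rewrite -eb.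
  by rewrite -ea -cu eac ec.
Qed.

End GoodWalk.

(** * Tables and search *)

Definition m_exp := IGet 0 (ILit 0).
Definition n_exp := IGet 0 (ILit 1).
Definition succ_exp e := IAdd e (ILit 1).

(** The machine cannot convert naturals to reals; the casts needed to compare costs with [B] are
    obtained by repeatedly adding 1. *)
Definition cast_prog :=
  For 0 (succ_exp (IAdd m_exp n_exp))
    (RSet 3 (succ_exp (counter 0)) (RAdd (RGet 3 (counter 0)) (RLit 1))).

(** Naturals cannot be multiplied by the machine, so row offsets are tabulated by repeated
    addition. *)
Definition offset_prog :=
  For 0 m_exp
    (Seq (ISet 5 (succ_exp (counter 0))
            (IAdd (IGet 5 (counter 0)) (IAdd n_exp (ILit 2))))
         (ISet 6 (succ_exp (counter 0))
            (IAdd (IGet 6 (counter 0)) (succ_exp (IAdd m_exp m_exp))))).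

Definition row_prog :=
  For 0 m_exp
    (Seq (RSet 4 (counter 0) (RLit 0))
       (For 1 (IAdd n_exp (ILit 2))
          (RSet 4 (counter 0)
             (RAdd (RGet 4 (counter 0))
                (RGet 1 (IAdd (IGet 5 (counter 0)) (counter 1))))))).

Definition best_exp h j := RGet 5 (IAdd (IGet 6 h) j).

(** Row 0 of the table is never written: the initial zeros are its correct values. *)
Definition dp_prog :=
  let skip := best_exp (counter 0) (succ_exp (counter 1)) in
  let take := RAdd (best_exp (counter 0) (counter 1)) (RGet 4 (counter 0)) in
  let cell := IAdd (IGet 6 (succ_exp (counter 0))) (succ_exp (counter 1)) in
  For 0 m_exp
    (Seq (RSet 5 (IGet 6 (succ_exp (counter 0))) (RLit 0))
       (For 1 (IAdd m_exp m_exp)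
          (If (BRLe skip take) (RSet 5 cell take) (RSet 5 cell skip)))).

Definition search_prog :=
  let dist := RAdd (RMul (RLit 2) (RGet 3 (counter 0)))
    (RMul (RLit 2) (RMul (RGet 3 (counter 1)) (RGet 3 (succ_exp n_exp)))) in
  let value := best_exp (succ_exp (counter 0)) (IAdd (counter 1) (counter 1)) in
  let record := RGet 6 (ILit 0) in
  For 0 m_exp
    (For 1 (succ_exp m_exp)
       (If (BAnd (BRLe dist (RGet 0 (ILit 0))) (BNot (BRLe value record)))
          (Seq (RSet 6 (ILit 0) value)
             (Seq (ISet 7 (ILit 0) (counter 0))
                  (ISet 7 (ILit 1) (IAdd (counter 1) (counter 1)))))
          Skip)).

Section Tables.
Variables (R : realType) (m n : nat) (r : vertex m n -> R) (B : R).
Hypotheses (m_gt0 : (0 < m)%N) (n_gt0 : (0 < n)%N).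
Implicit Type s : state R.
Local Notation M := (maxn n m).
Local Notation W := (m + m).+1.
Local Notation F := (best (row_reward r)).

(** The monomials to which the loop bounds expand; the time estimates below reduce to them. *)
Lemma size_bounds : [/\ (m * n <= m * M)%N, (m * m <= m * M)%N, (n <= m * M)%N,
  (m <= m * M)%N & (1 <= m * M)%N].
Proof.
have h1 : (n <= M)%N by exact: leq_maxl.
have h2 : (m <= M)%N by exact: leq_maxr.
by move: h1 h2; generalize M => k h1 h2; split; nia.
Qed.

Definition instance s :=
  [/\ imem s 0 0 = m, imem s 0 1 = n, rmem s 0 0 = B
    & forall v : vertex m n, rmem s 1 (vrow v * n.+2 + vcol v) = r v].

Definition casts s := forall i, (i <= m + n + 1)%N -> rmem s 3 i = i%:R.

Definition offsets s := forall i, (i <= m)%N ->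
  imem s 5 i = (i * n.+2)%N /\ imem s 6 i = (i * W)%N.

Definition rows s := forall i, (i < m)%N -> rmem s 4 i = row_reward r i.

Definition dp s := forall i j, (i <= m)%N -> (j <= m + m)%N ->
  rmem s 5 (i * W + j) = F i j.

Definition no_dp s := forall j, rmem s 5 j = 0.
Definition no_record s :=
  [/\ rmem s 6 0 = 0, imem s 7 0 = 0%N & imem s 7 1 = 0%N].
Definition no_output s := imem s 1 0 = 0%N /\ imem s 8 0 = 0%N.
(** The zeros that later phases rely on as initial values. *)
Definition untouched s := [/\ no_dp s, no_record s & no_output s].

Lemma runs_cast s :
  instance s -> untouched s -> rmem s 3 0 = 0 -> imem s 5 0 = 0%N ->
  imem s 6 0 = 0%N ->
  runs cast_prog s (3000 * (m * M)) (fun s => [/\ instance s, untouched s,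
    casts s, imem s 5 0 = 0%N & imem s 6 0 = 0%N]).
Proof.
move=> H1 H2 H3 H4 H5.
pose Inv k s := [/\ instance s, untouched s,
  forall i, (i <= k)%N -> rmem s 3 i = i%:R, imem s 5 0 = 0%N & imem s 6 0 = 0%N].
apply: runs_mono (@runs_for _ Inv (m + n + 1) 10 _ _ _ _ _ _ _ _) _ _.
- by [].
- by move=> k s' [[e1 e2 _ _] _ _ _ _]; rewrite /= e1 e2.
- move=> k s' kN [I1 I2 I3 I4 I5] ek; apply: runs_wp => //=.
  split=> //; split=> // i; rewrite ek addn1 leq_eqVlt /update /=.
  case: eqP => [-> _|_ /=]; first by rewrite I3 // natr1.
  exact: I3.
- by split=> // i; rewrite leqn0 => /eqP ->.
- by rewrite /=; case: size_bounds => *; nia.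
- by [].
Qed.

Lemma runs_offset s :
  instance s -> untouched s -> casts s -> imem s 5 0 = 0%N -> imem s 6 0 = 0%N ->
  runs offset_prog s (3000 * (m * M))
    (fun s => [/\ instance s, untouched s, casts s & offsets s]).
Proof.
move=> H1 H2 H3 H4 H5.
pose Inv k s := [/\ instance s, untouched s, casts s &
  forall i, (i <= k)%N -> imem s 5 i = (i * n.+2)%N /\ imem s 6 i = (i * W)%N].
apply: runs_mono (@runs_for _ Inv m 40 _ _ _ _ _ _ _ _) _ _.
- by [].
- by move=> k s' [[e1 e2 _ _] _ _ _]; rewrite /= e1.
- move=> k s' kN [I1 I2 I3 I4] ek; apply: runs_wp => //=.
  have [e1 e2 _ _] := I1; have [f1 f2] := I4 k (leqnn _).
  split=> //; split=> // i; rewrite /update /= ek addn1 f1 f2 e1 e2.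
  rewrite leq_eqVlt; case: eqP => [-> _|_ /=]; last exact: I4.
  by split; lia.
- by split=> // i; rewrite leqn0 => /eqP ->.
- by rewrite /=; case: size_bounds => *; nia.
- by [].
Qed.

Lemma row_reward_cells s i : instance s -> (i < m)%N ->
  \sum_(0 <= j < n.+2) rmem s 1 (i * n.+2 + j) = row_reward r i.
Proof.
move=> [_ _ _ Hr] im; rewrite big_mkord /row_reward.
rewrite (reindex_onto (fun j : 'I_n.+2 => (Ordinal im, j) : vertex m n) (fun v => v.2)) /=.
  apply: eq_big => [j|j _]; first by rewrite /vrow /= !eqxx.
  by rewrite -(Hr (Ordinal im, j)).
by move=> [a b] /eqP ea; congr (_, _); apply: val_inj.
Qed.

Lemma runs_row s :
  instance s -> untouched s -> casts s -> offsets s ->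
  runs row_prog s (3000 * (m * M)) (fun s => [/\ instance s, untouched s, casts s,
    offsets s & rows s]).
Proof.
move=> H1 H2 H3 H4.
pose Inv k s := [/\ instance s, untouched s, casts s, offsets s &
  forall i, (i < k)%N -> rmem s 4 i = row_reward r i].
apply: runs_mono (@runs_for _ Inv m (10 + n.+3 * 50) _ _ _ _ _ _ _ _) _ _.
- by [].
- by move=> k s' [[e1 e2 _ _] _ _ _]; rewrite /= e1.
- move=> k s' km [I1 I2 I3 I4 I5] ek; apply: runs_seq.
    apply: (@runs_wp _ _ _ _ (fun s => Inv k s /\ (imem s 4 0 = k /\ rmem s 4 k = 0))) => //=.
    split; last by rewrite /= /update ek /= eqxx.
    by split=> // i ik; rewrite /= /update /= ek (ltn_eqF ik) I5.
  move=> s1 [J1 [J2 J3]].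
  (* The inner loop runs on counter cell 1, so its invariant, unlike the outer one, may fix the
     value of cell 0. *)
  pose Inv' j s := Inv k s /\ (imem s 4 0 = k /\
    rmem s 4 k = \sum_(0 <= c < j) rmem s 1 (k * n.+2 + c)).
  apply: runs_mono (@runs_for _ Inv' n.+2 20 _ _ _ _ _ _ _ _) _ _.
  + by [].
  + by move=> j s2 [[[e1 e2 _ _] _ _ _ _] _]; rewrite /= e2 addn2.
  + move=> j s2 jn [[L1 L2 L3 L4 L5] [L6 L7]] ej; apply: runs_wp => //=.
    have [f1 f2] := L4 k (ltnW km).
    split=> //; split; last split.
    * by split=> // i ik; rewrite /= /update /= L6 (ltn_eqF ik) L5.
    * by [].
    * by rewrite /update /= L6 eqxx big_nat_recr //= L7 ej f1.
  + by split=> //; rewrite J3 big_geq.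
  + rewrite /=; lia.
  + move=> s2 [[L1 L2 L3 L4 L5] [L6 L7]]; split=> //; split=> // i.
    rewrite ltnS leq_eqVlt => /orP[/eqP ->|/L5//].
    by rewrite L7 row_reward_cells.
- by [].
- by rewrite /=; case: size_bounds => *; nia.
- by [].
Qed.

Lemma runs_dp s :
  instance s -> untouched s -> casts s -> offsets s -> rows s ->
  runs dp_prog s (3000 * (m * M)) (fun s => [/\ instance s, casts s,
    offsets s & dp s] /\ (no_record s /\ no_output s)).
Proof.
move=> H1 [H2 H2' H2''] H3 H4 H5.
pose Base s := [/\ instance s, casts s, offsets s & rows s] /\
  (no_record s /\ no_output s).
pose Inv k s := Base s /\ forall i j, (i <= k)%N -> (j <= m + m)%N ->
  rmem s 5 (i * W + j) = F i j.
apply: runs_mono (@runs_for _ Inv m (20 + W.+1 * 100) _ _ _ _ _ _ _ _) _ _.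
- by [].
- by move=> k s' [[[[e1 e2 _ _] _ _ _] _] _]; rewrite /= e1.
- move=> k s' km [[[I1 I2 I3 I4] I5] I6] ek; apply: runs_seq.
    apply: (@runs_wp _ _ _ _ (fun s => Inv k s /\ (imem s 4 0 = k /\
      forall j, (j <= 0)%N -> rmem s 5 (k.+1 * W + j) = F k.+1 j))) => //=.
    have [_ f2] := I3 k.+1 km.
    split; last first.
      split=> // j; rewrite leqn0 => /eqP ->.
      by rewrite /= /update /= ek addn1 f2 addn0 eqxx.
    (* Table rows do not overlap, since [j <= m + m] is below the row width [W]. *)
    split=> // i j ik jm; rewrite /= /update /= ek addn1 f2.
    by case: eqP => [|_]; [nia|exact: I6].
  move=> s1 [J1 [J2 J3]].
  pose Inv' l s := Inv k s /\ (imem s 4 0 = k /\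
      forall j, (j <= l)%N -> rmem s 5 (k.+1 * W + j) = F k.+1 j).
  apply: runs_mono (@runs_for _ Inv' (m + m) 70 _ _ _ _ _ _ _ _) _ _.
  + by [].
  + by move=> j s2 [[[[[e1 e2 _ _] _ _ _] _] _] _]; rewrite /= e1.
  + move=> l s2 lm [[[[L1 L2 L3 L4] L5] L6] [L7 L8]] el.
    have [_ f2] := L3 k.+1 km; have [_ f1] := L3 k (ltnW km).
    have wr x : x = F k.+1 l.+1 ->
        Inv' l.+1 (State (imem s2) (update (rmem s2) 5 (k.+1 * W + l.+1) x)).
      move=> ex; split; last split=> //.
        split=> // i j ik jm; rewrite /= /update /=.
        by case: eqP => [|_]; [nia|exact: L6].
      move=> j; rewrite leq_eqVlt => /orP[/eqP ->|jl].
        by rewrite /= /update /= eqxx.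
      rewrite /= /update /=; case: eqP => [|_]; [lia|exact: L8].
    apply: runs_wp => //=.
    rewrite !L7 !el !addn1 f2 f1 !L6 ?L4; try lia.
    by case: leP => le; split=> //; apply: wr => /=;
      [rewrite (max_idPr _) | rewrite (max_idPl (ltW _))].
  + by split.
  + rewrite /=; lia.
  + move=> s2 [[L1 L6] [L7 L8]]; split=> //; split=> // i j.
    by rewrite leq_eqVlt => /orP[/eqP ->|]; [exact: L8 | exact: L6].
- split=> // i j; rewrite leqn0 => /eqP -> _; exact: H2.
- by rewrite /=; case: size_bounds => *; nia.
- by move=> s' [[[I1 I2 I3 I4] I5] I6].
Qed.

Definition affordable h q := (2 * h + 2 * (q * n.+1))%:R <= B.

(** The pairs already examined are those lexicographically below [(k, l)]. *)
Definition record_upto (k l : nat) s := exists h q,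
  [/\ (h < m)%N, (q <= m)%N & affordable h q] /\
  [/\ imem s 7 0 = h, imem s 7 1 = (q + q)%N, rmem s 6 0 = F h.+1 (q + q) &
   forall h' q', (h' < k)%N && (q' <= m)%N || (h' == k) && (q' < l)%N ->
     affordable h' q' -> F h'.+1 (q' + q') <= rmem s 6 0].

Lemma runs_search s : 0 <= B ->
  instance s -> casts s -> offsets s -> dp s -> no_record s -> no_output s ->
  runs search_prog s (3000 * (m * M)) (fun s => [/\ instance s,
    offsets s, dp s, no_output s & record_upto m 0 s]).
Proof.
move=> B_ge0 H1 H2 H3 H4 [H5 H5' H5''] H6.
pose Base s := [/\ instance s, casts s, offsets s, dp s & no_output s].
pose Inv k s := Base s /\ record_upto k 0 s.
apply: runs_mono (@runs_for _ Inv m (m.+2 * 130) _ _ _ _ _ _ _ _) _ _.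
- by [].
- by move=> k s' [[[e1 e2 _ _] _ _ _ _] _]; rewrite /= e1.
- move=> k s' km [I1 I2] ek.
  pose Inv' l s := Base s /\ (imem s 4 0 = k /\ record_upto k l s).
  apply: runs_mono (@runs_for _ Inv' m.+1 100 _ _ _ _ _ _ _ _) _ _.
  + by [].
  + by move=> l s2 [[[e1 e2 _ _] _ _ _ _] _]; rewrite /= e1 addn1.
  + move=> l s2 lm [[L1 L2 L3 L4 L5] [L6 L7]] el.
    have [_ f2] := L3 k.+1 km; have [_ e2 eB _] := L1.
    have af : 2%:R * k%:R + 2%:R * (l%:R * n.+1%:R) <= B = affordable k l.
      by rewrite /affordable natrD !natrM.
    apply: runs_wp => //=; rewrite L6 el e2 !addn1 f2 eB L4 ?L2; try lia.
    rewrite af; have [h [q [[hm qm ahq] [g1 g2 g3 g4]]]] := L7.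
    case: ifP => [/andP[akl lt]|naf].
      split=> //; split=> //; split=> //; exists k, l; split=> //.
      split=> //; rewrite /= ?/update /= ?f2 ?L6 ?el ?addn1 //.
      move=> h' q' hq a'; case: (boolP ((h' == k) && (q' == l))).
        by move=> /andP[/eqP -> /eqP ->].
      move=> ne; apply: le_trans (g4 _ _ _ a') _; first by lia.
      by apply: ltW; rewrite ltNge.
    split=> //; split=> //; split=> //; exists h, q; split=> //; split=> //.
    move=> h' q' hq a'; case: (boolP ((h' == k) && (q' == l))).
      move=> /andP[/eqP eh /eqP eq]; move: naf; rewrite -eh -eq a' /=.
      by move/negbFE.
    by move=> ne; apply: g4 a'; lia.
  + by [].
  + rewrite /=; lia.
  + move=> s2 [L1 [L2 L3]]; split=> //; split=> //.
    have [h [q [A1 [g1 g2 g3 g4]]]] := L3.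
    exists h, q; split=> //; split=> // h' q' hq; apply: g4; lia.
(* The zero memory already encodes a valid record: the pair [(0, 0)] costs 0, which [B] allows, and
   its value is [F 1 0 = 0]. *)
- split=> //; exists 0%N, 0%N; split.
    by split=> //; rewrite /affordable.
  by rewrite H5' H5'' H5; split=> // h q; rewrite ltn0 ltn0 andbF.
- by rewrite /=; case: size_bounds => *; nia.
- by move=> s' [[I1 I2 I3 I4 I5] I6].
Qed.

End Tables.

(** * Emission of the walk *)

Definition emit_prog row col :=
  let pos := IGet 1 (ILit 0) in
  Seq (ISet 2 pos row) (Seq (ISet 3 pos col) (ISet 1 (ILit 0) (succ_exp pos))).

Definition cross_prog (rightward : bool) row :=
  Seq (For 1 (succ_exp n_exp)
         (emit_prog row
            (if rightward then succ_exp (counter 1) else ISub n_exp (counter 1))))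
      (ISet 8 (ILit 0) (if rightward then succ_exp n_exp else ILit 0)).

Definition column_exp := IGet 8 (ILit 0).
Definition far_row := IGet 7 (ILit 0).
Definition crossings_left := IGet 7 (ILit 1).
Definition cur_row := ISub far_row (counter 0).

Definition down_prog :=
  Seq (emit_prog (ILit 0) (ILit 0))
      (For 0 far_row (emit_prog (succ_exp (counter 0)) (ILit 0))).

Definition take_prog :=
  If (BNot (BRLe (best_exp (succ_exp cur_row) crossings_left)
                 (best_exp cur_row crossings_left)))
     (Seq (If (BILe column_exp (ILit 0))
             (cross_prog true cur_row) (cross_prog false cur_row))
          (ISet 7 (ILit 1) (ISub crossings_left (ILit 1))))
     Skip.

Definition climb_prog :=
  If (BILe (ILit 1) cur_row)
     (emit_prog (ISub cur_row (ILit 1)) column_exp) Skip.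

Definition up_prog := For 0 (succ_exp far_row) (Seq take_prog climb_prog).

Definition return_prog :=
  If (BILe column_exp (ILit 0)) Skip (cross_prog false (ILit 0)).

Definition walk_prog := Seq down_prog (Seq up_prog return_prog).

Section Emit.
Variable R : realType.
Implicit Type s : state R.

Definition emitted s a b : state R :=
  let p := imem s 1 0 in
  State (update (update (update (imem s) 2 p a) 3 p b) 1 0 p.+1) (rmem s).

(** The column is evaluated after the row has been stored, hence the intermediate state in the
    second hypothesis. *)
Lemma emit_wp s row col a b Q :
  ieval s row = a -> ieval (iset s 2 (imem s 1 0) a) col = b ->
  Q (emitted s a b) -> wp (emit_prog row col) Q s.
Proof.
move=> ea eb; rewrite /= ea.
move: eb; rewrite /iset => ->.
by rewrite addn1.
Qed.

Lemma output_emitted s a b : output (emitted s a b) = rcons (output s) (a, b).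
Proof.
rewrite /output (_ : imem (emitted s a b) 1 0 = (imem s 1 0 + 1)%N); last first.
  by rewrite addn1.
rewrite iotaD map_cat add0n cats1 /= /update /= !eqxx; congr rcons.
apply/eq_in_map => k; rewrite mem_iota add0n => /andP[_ kp].
by rewrite (ltn_eqF kp).
Qed.

Definition frame s s' :=
  [/\ rmem s' = rmem s, imem s' 0 = imem s 0, imem s' 5 = imem s 5,
      imem s' 6 = imem s 6 & imem s' 7 = imem s 7] /\
  imem s' 4 0 = imem s 4 0.

(** [side] mirrors the columns of a leftward crossing, so that one invariant serves both
    directions. *)
Lemma runs_cross m n (b : bool) row s i x :
  let side c := if b then c else (n.+1 - c)%N in
  (itime row <= 10)%N -> (forall s', frame s s' -> ieval s' row = i) ->
  imem s 0 1 = n -> good_walk m n (output s) x (i, side 0%N) -> (i < m)%N ->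
  runs (cross_prog b row) s (n.+2 * 100 + 20) (fun s' =>
    [/\ frame s s', imem s' 8 0 = side n.+1,
     (exists x', good_walk m n (output s') x' (i, side n.+1)),
     size (output s') = (size (output s) + n.+1)%N &
     {subset output s <= output s'} /\
     forall c, (c <= n.+1)%N -> (i, c) \in output s']).
Proof.
move=> side trow erow en gw im.
(* The predecessor's column excludes a reversal at the next step; it is known only for [0 < k], and
   at [k = 0] the walk is at a row end, where reversing is allowed. *)
pose Inv k s' := frame s s' /\ [/\ exists2 x',
      good_walk m n (output s') x' (i, side k) &
      (0 < k)%N -> x'.2 = side k.-1,
  size (output s') = (size (output s) + k)%N,
  {subset output s <= output s'} &
  forall c, (c <= k)%N -> (i, side c) \in output s'].
apply: runs_seq.
  apply: (@runs_for _ Inv n.+1 76 _ _ _ _ _ _ _ _).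
  - by [].
  - by move=> k s' [[[_ e _ _ _] _] _]; rewrite /= e en addn1.
  - move=> k s' kn [fr [[x' gw' ex'] sz sub mem]] ek; apply: runs_wp; last first.
      by rewrite /=; case: (b) => /=; lia.
    have [[_ e0 _ _ _] _] := fr.
    apply: (@emit_wp _ _ _ i (side k.+1)).
    + exact: erow.
    + by rewrite /side; case: (b); rewrite /= ?/update /= ek ?e0 ?en; lia.
    split=> //; split; first exact: fr.
    rewrite output_emitted; split.
    + exists (i, side k) => //; apply: good_step gw' _ _ _ _ => //=.
      * rewrite /nadj /= eqxx /= /consecutive /side.
        by case: (b); lia.
      * move=> ik exz; have := ex' _; rewrite exz /=.
        by move: ik; rewrite /side; case: (b); lia.
      * by rewrite /side; case: (b); lia.
    + by rewrite size_rcons sz addnS.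
    + by move=> u /sub us; rewrite mem_rcons inE us orbT.
    + move=> c; rewrite mem_rcons inE leq_eqVlt => /orP[/eqP ->|/mem ->].
        by rewrite eqxx.
      by rewrite orbT.
  - split=> //; split=> //; rewrite ?addn0 //; first by exists x.
    move=> c; rewrite leqn0 => /eqP ->.
    by case: gw => [|l ? ? z ? ? ? ? ?]; rewrite ?inE ?mem_rcons ?inE eqxx.
move=> s' [fr [[x' gw' ex'] sz sub mem]].
apply: runs_wp; last by rewrite /=; case: (b) => /=; lia.
rewrite /cross_prog /=; split=> //.
- have [[_ e0 _ _ _] _] := fr.
  by rewrite /= /update /= /side; case: (b); rewrite /= ?e0 ?en; lia.
- by exists x'.
- split=> // c cn; have := mem (side c); rewrite /side.
  by case: (b) => [|h]; [exact | rewrite -[c](@subKn _ n.+1) //; apply: h; lia].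
Qed.
End Emit.

(** * Descent, backtracking on the way up, and return *)

Section Walk.
Variables (R : realType) (m n : nat) (r : vertex m n -> R) (B : R).
Hypotheses (m_gt0 : (0 < m)%N) (n_gt0 : (0 < n)%N).
Hypothesis r_ge0 : forall v, 0 <= r v.
Implicit Type s : state R.
Local Notation M := (maxn n m).
Local Notation W := (m + m).+1.
Local Notation F := (best (row_reward r)).
Variables hb K : nat.
Hypotheses (hb_lt : (hb < m)%N) (K_le : (K <= m + m)%N).

Definition tables s := [/\ instance r B s, offsets m n s & dp r s].

Definition side d := if odd d then n.+1 else 0%N.

(** Only rows from [i] on count, so the reward of a row is credited once, when that row is
    decided. *)
Definition collected i (l : seq (nat * nat)) : R :=
  \sum_(v : vertex m n | (i <= vrow v)%N && (coords v \in l)) r v.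

Lemma ler_sum_sub (P Q : pred (vertex m n)) : (forall v, P v -> Q v) ->
  \sum_(v | P v) r v <= \sum_(v | Q v) r v.
Proof.
move=> PQ; rewrite big_mkcond [leRHS]big_mkcond; apply: ler_sum => v _.
by case: ifP => [/PQ ->//|_]; case: ifP.
Qed.

Lemma collected_sub i l l' : {subset l <= l'} ->
  collected i.+1 l <= collected i l'.
Proof.
by move=> sub; apply: ler_sum_sub => v /andP[/ltnW -> /sub ->].
Qed.

Lemma collected_row i l l' : {subset l <= l'} ->
  (forall c, (c <= n.+1)%N -> (i, c) \in l') ->
  row_reward r i + collected i.+1 l <= collected i l'.
Proof.
move=> sub row; rewrite [leRHS](bigID (fun v : vertex m n => vrow v == i)) /=.
apply: lerD; apply: ler_sum_sub => v.
  move=> /eqP e; rewrite e leqnn eqxx andbT /=.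
  by rewrite /coords e; apply: row; rewrite -ltnS; exact: ltn_ord.
by move=> /andP[iv /sub ->]; rewrite (ltnW iv) /= neq_ltn iv orbT.
Qed.

(** Rows from [done] on are decided, [d] crossings are made and [j] remain. The reward secured plus
    the best value still reachable never falls below the target [F hb.+1 K]. *)
Definition walking (done cur : nat) s :=
  [/\ tables s, imem s 7 0 = hb & exists x j d,
  [/\ imem s 7 1 = j, (j + d)%N = K, imem s 8 0 = side d,
      good_walk m n (output s) x (cur, side d) &
      size (output s) = (hb + (hb - cur) + 1 + d * n.+1)%N] /\
  F hb.+1 K <= F done j + collected done (output s)].

Lemma runs_down s : tables s -> imem s 7 0 = hb -> imem s 7 1 = K ->
  no_output s -> runs down_prog s (1000 * (m * M)) (walking hb.+1 hb).
Proof.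
move=> ts e7 eK [e1 e8].
pose Inv k s' := [/\ tables s', imem s' 7 0 = hb, imem s' 7 1 = K,
  imem s' 8 0 = 0%N & (exists x, good_walk m n (output s') x (k, 0%N)) /\
  size (output s') = k.+1].
apply: runs_mono.
- apply: (@runs_seq _ _ _ _ 30 _ (Inv 0%N)).
    apply: runs_wp => //; apply: (@emit_wp _ _ _ _ 0%N 0%N) => //.
    split=> //; rewrite output_emitted.
    have -> : output s = [::] by rewrite /output e1.
    by split=> //; exists (0, 0)%N; exact: good_start.
  move=> s1 I0; apply: (@runs_for _ Inv hb 30 _ _ _ _ _ _ _ _).
  + by [].
  + by move=> k s' [_ e _ _ _].
  + move=> k s' kh [I1 I2 I3 I4 [[x gw] sz]] ek; apply: runs_wp => //.
    apply: (@emit_wp _ _ _ _ k.+1 0%N) => //; first by rewrite /= ek addn1.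
    split=> //; split=> //; rewrite output_emitted; split.
      exists (k, 0%N); apply: good_step gw _ _ _ _ => //=; last by lia.
      by rewrite /nadj /= /consecutive !eqxx orbT.
    by rewrite size_rcons sz.
  + by [].
- by rewrite /=; case: (@size_bounds m n) => // *; nia.
- move=> s' [I1 I2 I3 I4 [[x gw] sz]]; split=> //; exists x, K, 0%N; split.
    by split=> //; rewrite ?addn0 // sz; lia.
  by rewrite lerDl; apply: sumr_ge0.
Qed.

(** By [best_skip] a skipped row loses nothing; by [best_take] a crossed row trades one remaining
    crossing for its full reward, which [collected_row] credits. *)
Lemma runs_take i s : (i <= hb)%N -> walking i.+1 i s ->
  imem s 4 0 = (hb - i)%N ->
  runs take_prog s (n.+2 * 100 + 100)
    (fun s' => walking i i s' /\ imem s' 4 0 = (hb - i)%N).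
Proof.
move=> ih [ts e7 [x [j [d [[ej jd e8 gw sz] le]]]]] e4.
have [H1 H2 H3] := ts.
have er : (hb - (hb - i))%N = i by lia.
have im : (i < m)%N by exact: leq_ltn_trans ih hb_lt.
have [_ f1] := H2 i.+1 im; have [_ f2] := H2 i (ltnW im).
apply: runs_le (runs_if (T := n.+2 * 100 + 50) _ _) _; last first.
- by rewrite /=; lia.
- rewrite /= e4 e7 er ej addn1 f1 f2 !H3 ?negbK; try lia.
  move=> sk; apply: runs_wp; last by rewrite /=; lia.
  split=> //; split=> //; exists x, j, d; split=> //.
  apply: le_trans le _; rewrite (best_skip sk) lerD2l.
  exact: collected_sub.
rewrite /= e4 e7 er ej addn1 f1 f2 !H3; try lia.
move=> /best_take[j_gt0 eF].
apply: runs_le.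
- apply: (@runs_seq _ _ _ _ (n.+2 * 100 + 30) 10 (fun s' => [/\ frame s s',
     imem s' 8 0 = side d.+1,
     (exists x', good_walk m n (output s') x' (i, side d.+1)),
     size (output s') = (size (output s) + n.+1)%N &
     {subset output s <= output s'} /\
     forall c, (c <= n.+1)%N -> (i, c) \in output s'])).
  + have eval_row s' : frame s s' -> ieval s' cur_row = i.
      by move=> [[_ _ _ _ e7'] e4']; rewrite /= e7' e4' e4 e7 er.
    have en : imem s 0 1 = n by case: H1.
    apply: runs_le (runs_if (T := n.+2 * 100 + 20) _ _) _; last first.
    * by rewrite /=; lia.
    * rewrite /= e8 => od; have {}od : odd d by move: od; rewrite /side; case: odd.
      move: gw; rewrite {1}/side od => gw.
      by have := runs_cross (b := false) _ eval_row en gw im;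
        rewrite /= /side /= od subnn; exact.
    * rewrite /= e8 => od.
      have {}od : odd d = false by move: od; rewrite /side; case: odd.
      move: gw; rewrite {1}/side od => gw.
      by have := runs_cross (b := true) _ eval_row en gw im;
        rewrite /= /side /= od; exact.
  + move=> s' [[[F1 F2 F3 F4 F5] F6] g8 [x' gw'] sz' [sub row]].
    apply: runs_wp => //=; split; last by rewrite -e4.
    split; last exists x', j.-1, d.+1; last split.
    * split.
      - have [A1 A2 A3 A4] := H1.
        by split; rewrite /= /update /= ?F1 ?F2.
      - by move=> k km; have := H2 k km; rewrite /= /update /= F3 F4.
      - by move=> k l km lm; rewrite /= F1; exact: H3.
    * by rewrite /= /update /= F5.
    * split=> //.
      - by rewrite /= /update /= F5 ej subn1.
      - by lia.
      - by rewrite [size _]sz' sz; lia.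
    * apply: le_trans le _; rewrite eF -addrA lerD2l.
      exact: collected_row.
- by lia.
Qed.

Lemma runs_climb i s : (i <= hb)%N -> walking i i s ->
  imem s 4 0 = (hb - i)%N ->
  runs climb_prog s 60
    (fun s' => walking i i.-1 s' /\ imem s' 4 0 = (hb - i)%N).
Proof.
move=> ih wk e4; have [ts e7 [x [j [d [[ej jd e8 gw sz] le]]]]] := wk.
have er : (hb - (hb - i))%N = i by lia.
apply: runs_le (runs_if (T := 40) _ _) _; last first.
- by [].
- rewrite /= e4 e7 er -ltnNge ltnS leqn0 => /eqP i0.
  by apply: runs_wp => //; subst i.
rewrite /= e4 e7 er => i_gt0; apply: runs_wp => //.
apply: (@emit_wp _ _ _ _ i.-1 (side d)).
- by rewrite /= e4 e7 er subn1.
- by rewrite /= /update /= e8.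
split=> //; split=> //; exists (i, side d), j, d; split; last first.
  rewrite output_emitted; apply: le_trans le _; rewrite lerD2l.
  by apply: ler_sum_sub => v /andP[->]; rewrite mem_rcons inE => ->; rewrite orbT.
split=> //; rewrite output_emitted; last by rewrite size_rcons sz; lia.
apply: good_step gw _ _ _ _ => /=.
- rewrite /nadj /= /consecutive eqxx /=.
  rewrite (_ : (side d == 0%N) || (side d == n.+1)) /=; first by lia.
  by rewrite /side; case: odd; rewrite eqxx ?orbT.
- by rewrite /side; case: odd; rewrite ?ltnn ?andbF.
- by lia.
- by rewrite /side; case: odd.
Qed.

Lemma runs_up s : walking hb.+1 hb s ->
  runs up_prog s (3000 * (m * M)) (walking 0 0).
Proof.
move=> H0.
pose Inv k s := walking (hb.+1 - k) (hb - k) s.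
apply: runs_mono.
- apply: (@runs_for _ Inv hb.+1 (n.+2 * 100 + 160) _ _ _ _ _ _ _ _).
  + by [].
  + by move=> k s' [_ e _]; rewrite /= e addn1.
  + move=> k s' kh H ek.
    have H' : walking (hb - k).+1 (hb - k) s' by rewrite -subSn.
    have ek' : imem s' 4 0 = (hb - (hb - k))%N by rewrite ek; lia.
    apply: runs_mono.
    * apply: runs_seq (runs_take _ H' ek') _; first by lia.
      by move=> s1 [J1 J2]; apply: runs_climb J1 J2; lia.
    * by lia.
    * move=> s1 [J1 J2]; split; last by rewrite J2; lia.
      by rewrite /Inv subSS subnS.
  + by rewrite /Inv !subn0.
- by rewrite /=; case: (@size_bounds m n) => // *; nia.
- by rewrite /Inv subnn subnS subnn.
Qed.

Lemma runs_return s : walking 0 0 s -> ~~ odd K ->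
  runs return_prog s (1000 * (m * M)) (fun s' => exists x,
    [/\ good_walk m n (output s') x (0, 0)%N,
        (size (output s') <= (2 * hb + K * n.+1).+1)%N &
        F hb.+1 K <= collected 0 (output s')]).
Proof.
move=> [ts e7 [x [j [d [[ej jd e8 gw sz] le]]]]] oK.
have F0 : F 0 j = 0 by [].
rewrite F0 add0r in le.
have [[_ en _ _] _ _] := ts.
apply: runs_le (runs_if (T := n.+2 * 100 + 20) _ _) _; last first.
- by rewrite /=; case: (@size_bounds m n) => // *; nia.
- rewrite /= e8 => od; have {}od : odd d by move: od; rewrite /side; case: odd.
  move: gw; rewrite /side od => gw.
  apply: runs_mono (runs_cross (b := false) (row := ILit 0) _ _ en gw m_gt0) _ _ => //.
  move=> s' /= [_ _ [x']]; rewrite subnn => gw' sz' [sub _]; exists x'; split=> //.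
    (* Since [d] is odd and [K] even, at least one crossing is left to pay for the way back along
       row 0. *)
    have dK : (d.+1 <= K)%N.
      by rewrite ltn_neqAle (_ : (d <= K)%N) ?andbT; [apply: contraNneq oK => <- | lia].
    have : (d.+1 * n.+1 <= K * n.+1)%N by rewrite leq_mul2r dK orbT.
    by rewrite sz' sz; lia.
  apply: le_trans le _; apply: ler_sum_sub => v /andP[_ /sub ->].
  by rewrite leq0n.
- rewrite /= e8 => od.
  have {}od : odd d = false by move: od; rewrite /side; case: odd.
  move: gw; rewrite /side od => gw; apply: runs_wp; last by rewrite /=; lia.
  exists x; split=> //; rewrite sz.
  have : (d * n.+1 <= K * n.+1)%N by rewrite leq_mul2r; lia.
  by lia.
Qed.

Lemma runs_walk s : tables s -> imem s 7 0 = hb -> imem s 7 1 = K ->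
  no_output s -> ~~ odd K ->
  runs walk_prog s (5000 * (m * M)) (fun s' => exists x,
    [/\ good_walk m n (output s') x (0, 0)%N,
        (size (output s') <= (2 * hb + K * n.+1).+1)%N &
        F hb.+1 K <= collected 0 (output s')]).
Proof.
move=> ts e7 eK eo oK.
apply: runs_le.
- apply: runs_seq (runs_down ts e7 eK eo) _ => s1 J1.
  apply: runs_seq (runs_up J1) _ => s2 J2.
  exact: runs_return J2 oK.
- by lia.
Qed.

End Walk.

(** * The complete program and its optimality *)

Definition cop_fr_prog :=
  Seq cast_prog (Seq offset_prog (Seq row_prog (Seq dp_prog
    (Seq search_prog walk_prog)))).

Lemma input_instance (R : realType) m n (r : vertex m n -> R) B :
  instance r B (input r B).
Proof.
split=> //= v; case: pickP => [u /eqP e|/(_ v)]; last by rewrite eqxx.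
have eu : u = v; last by rewrite eu.
case: u v e => [u1 u2] [v1 v2] /=; rewrite /vrow /vcol /= => e.
have lu := ltn_ord u2; have lv := ltn_ord v2.
(* Columns are below [n.+2], so a row-major address determines its row and column. *)
have e1 : u1 = v1 :> nat by nia.
by congr (_, _); apply: val_inj => //=; nia.
Qed.

Theorem theorem1 (R : realType) :
  exists (p : cmd) (C : nat),
  forall (m n : nat) (r : vertex m n -> R) (B : R),
    (1 <= m)%N -> (1 <= n)%N ->
    (forall v : vertex m n, 0 <= r v) ->
    (forall v : vertex m n, vcol v = 0%N \/ vcol v = n.+1 -> r v = 0) ->
    0 <= B ->
    exists (t : nat) (s : state R) (w : seq (vertex m n)),
      [/\ exec p (input r B) t s,
          (t <= C * (m * maxn n m))%N,
          output s = [seq (vrow v, vcol v) | v <- w]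
        & COP_FR_optimal r B w].
Proof.
(* Five phases of 3000 each and the walk with 5000 add up to this constant. *)
exists cop_fr_prog, (4 * 5000)%N => m n r B m_gt0 n_gt0 r_ge0 r_bd B_ge0.
suff [t [s [E le [w [ow opt]]]]] : runs cop_fr_prog (input r B)
    (4 * 5000 * (m * maxn n m)) (fun s => exists w : seq (vertex m n),
      output s = [seq (vrow v, vcol v) | v <- w] /\ COP_FR_optimal r B w).
  by exists t, s, w.
apply: runs_le.
- apply: runs_seq (runs_cast m_gt0 n_gt0 (input_instance r B) _ _ _ _) _ => //.
  move=> s1 [I1 I2 I3 I4 I5].
  apply: runs_seq (runs_offset m_gt0 n_gt0 I1 I2 I3 I4 I5) _ => {I1 I2 I3 I4 I5}.
  move=> s2 [I1 I2 I3 I4].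
  apply: runs_seq (runs_row m_gt0 n_gt0 I1 I2 I3 I4) _ => {I1 I2 I3 I4}.
  move=> s3 [I1 I2 I3 I4 I5].
  apply: runs_seq (runs_dp m_gt0 n_gt0 I1 I2 I3 I4 I5) _ => {I1 I2 I3 I4 I5}.
  move=> s4 [[I1 I2 I3 I4] [I5 I6]].
  apply: runs_seq (runs_search m_gt0 n_gt0 B_ge0 I1 I2 I3 I4 I5 I6) _ => {I1 I2 I3 I4 I5 I6}.
  move=> s5 [I1 I2 I3 I4 [h [q [[hm qm ahq] [e1 e2 e3 ub]]]]].
  have qq : (q + q <= m + m)%N by exact: leq_add.
  have oq : ~~ odd (q + q) by rewrite addnn odd_double.
  apply: runs_mono (runs_walk m_gt0 n_gt0 r_ge0 hm qq (And3 I1 I2 I3) e1 e2 I4 oq) _ _.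
    exact: leqnn.
  move=> s6 [x [gw sz le]].
  have [v [p [[v0 ow pp lp fr] _]]] := good_walkP m_gt0 gw.
  exists (v :: p); split=> //; split.
    split=> //.
      have ev : last v p = v by apply: coords_inj; rewrite lp.
      by case: v0 => r0 c0; rewrite /closed_walk r0 c0 pp ev !eqxx.
    apply: le_trans ahq; rewrite ler_nat.
    by move: sz; rewrite ow size_map /cost /=; lia.
  (* For a competitor [w] the chain is: its reward, the sum of the rows in [S], the table value at
     an affordable pair, the record, the reward of the emitted walk. *)
  move=> w [cw fw cB].
  have [q' [h' [S [h'm Sh wS cS cost_ge]]]] := full_row_cost n_gt0 m_gt0 cw fw.
  (* The search only tries [q <= m]. Truncating [q'] lowers the cost and still leaves room for [S],
     which has at most [m] rows. *)
  have q'm : (minn q' m <= m)%N by exact: geq_minr.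
  have a' : affordable n B h' (minn q' m).
    apply: le_trans cB; rewrite ler_nat; apply: leq_trans cost_ge.
    by rewrite leq_add2l leq_mul2l /= leq_mul2r geq_minl orbT.
  have cS' : (#|S| <= minn q' m + minn q' m)%N.
    have cSm : (#|S| <= m)%N by have := max_card (mem S); rewrite card_ord.
    by move: #|S| cSm cS => c; lia.
  apply: le_trans (reward_le_rows r_ge0 r_bd wS) _.
  apply: le_trans (best_ub _ (h := h'.+1) _ cS') _; first by move=> i /Sh.
  apply: le_trans (ub _ _ _ a') _; first by rewrite h'm q'm.
  rewrite e3; apply: le_trans le _; rewrite le_eqVlt; apply/orP; left; apply/eqP.
  by apply: eq_bigl => u; rewrite leq0n ow (mem_map (@coords_inj _ _)).
- by move: (m * maxn n m)%N => c; lia.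
Qed.
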